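(* Let $m\ge n\ge1$. Let $\mathcal{P}(m,n)\subset\mathbb{R}^m$ be the convex hull of all $x\in\{0,1,\dots,n\}^m$ whose nonzero entries are pairwise distinct, and let $\mathcal{P}'(m,n)=\{(x,\binom{n+1}{2}-\sum_{i=1}^m x_i):x\in\mathcal{P}(m,n)\}\subset\mathbb{R}^{m+1}$. Let $f_{m,n}:2^{[m+1]}\to\mathbb{Z}_{\ge0}$ be given by $f_{m,n}(A)=\min(|A|,n)$ if $m+1\notin A$ and $f_{m,n}(A)=n$ if $m+1\in A$. Then $\mathcal{P}'(m,n)$ is normally equivalent to the monotone path polytope $\mathrm{MPP}_{\mathbf{1}}(P_{f_{m,n}})$, i.e. to the base polytope of the flag polymatroid of $f_{m,n}$.
   Context: $f_{m,n}$ is a polymatroid. For a polymatroid $f$ on $E$, $P_f=\{x\in\mathbb{R}^E:x\ge0,\sum_{e\in A}x_e\le f(A)\ \forall A\}$, and $\mathbf{1}(x)=\sum_e x_e$. $\mathrm{MPP}_c(P)=\{2\int_I\gamma(s)\,ds\}$ over continuous sections $\gamma:I=c(P)\to P$ with $\langle c,\gamma(s)\rangle=s$; by a result of the paper, $\mathrm{MPP}_{\mathbf{1}}(P_f)$ is the base polytope of the polymatroid $A\mapsto 2f(E)f(A)-f(A)^2$. Normally equivalent: same normal fan. *)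

(* Defs.v *)
From HB Require Import structures.
From mathcomp Require Import all_boot all_order all_algebra.
From mathcomp Require Import all_classical all_reals all_analysis.

Set Implicit Arguments.
Unset Strict Implicit.
Unset Printing Implicit Defensive.

Import Order.TTheory GRing.Theory Num.Theory.
Import numFieldNormedType.Exports.

Local Open Scope classical_set_scope.
Local Open Scope ring_scope.

(* Points and linear functionals of R^d are both row vectors. *)
Definition dot (R : realType) (d : nat) (c x : 'rV[R]_d) : R :=
  \sum_(i < d) c 0 i * x 0 i.

Definition conv_hull (R : realType) (d : nat) (S : set 'rV[R]_d) :
  set 'rV[R]_d := smallest (@convex_set R 'rV[R]_d) S.

(** Normal fans *)

Definition face (R : realType) (d : nat) (P : set 'rV[R]_d) (c : 'rV[R]_d) :
  set 'rV[R]_d := [set x | P x /\ forall y, P y -> dot c y <= dot c x].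

Definition normal_cone (R : realType) (d : nat) (P F : set 'rV[R]_d) :
  set 'rV[R]_d := [set c | F `<=` face P c].

(* For a nonempty polytope P, the sets [face P c] are exactly its nonempty
   faces, P itself being [face P 0]. *)
Definition normal_fan (R : realType) (d : nat) (P : set 'rV[R]_d) :
  set (set 'rV[R]_d) :=
  [set N | exists c : 'rV[R]_d, N = normal_cone P (face P c)].

Definition normally_equivalent (R : realType) (d : nat) (P Q : set 'rV[R]_d) :
  Prop := normal_fan P = normal_fan Q.

(** Monotone path polytopes *)

Definition monotone_section (R : realType) (d : nat) (c : 'rV[R]_d)
    (P : set 'rV[R]_d) (gamma : R -> 'rV[R]_d) : Prop :=
  {within dot c @` P, continuous gamma} /\
  (forall s, (dot c @` P) s -> P (gamma s) /\ dot c (gamma s) = s).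

Definition MPP (R : realType) (d : nat) (c : 'rV[R]_d) (P : set 'rV[R]_d) :
  set 'rV[R]_d :=
  [set x | exists2 gamma, monotone_section c P gamma &
    x = 2 *: \row_(i < d)
              \int[lebesgue_measure]_(s in dot c @` P) (gamma s 0 i)].

(** Polytopes of a set function f on the ground set 'I_d *)

Definition polymatroid_polytope (R : realType) (d : nat)
    (f : {set 'I_d} -> R) : set 'rV[R]_d :=
  [set x | (forall i, 0 <= x 0 i) /\
           (forall A : {set 'I_d}, \sum_(i in A) x 0 i <= f A)].

Definition base_polytope (R : realType) (d : nat)
    (f : {set 'I_d} -> R) : set 'rV[R]_d :=
  [set x | polymatroid_polytope f x /\
           \sum_(i < d) x 0 i = f (finset.setTfor 'I_d)].

Definition flag_polymatroid (R : realType) (d : nat)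
    (f : {set 'I_d} -> R) : {set 'I_d} -> R :=
  fun A => 2 * f (finset.setTfor 'I_d) * f A - f A ^+ 2.

(** Partial permutohedra.  The (m+1)-st coordinate of R^(m+1), and the element
    m+1 of the ground set, is [rshift m ord0 : 'I_(m + 1)]. *)

Definition partial_permutation (R : realType) (m n : nat) : set 'rV[R]_m :=
  [set x | (forall i, exists2 k : nat, (k <= n)%N & x 0 i = k%:R) /\
           (forall i j, x 0 i != 0 -> x 0 j != 0 -> i != j ->
              x 0 i != x 0 j)].

Definition partial_permutohedron (R : realType) (m n : nat) : set 'rV[R]_m :=
  conv_hull (@partial_permutation R m n).

Definition lifted_partial_permutohedron (R : realType) (m n : nat) :
  set 'rV[R]_(m + 1) :=
  [set row_mx x (const_mx ('C(n.+1, 2)%:R - \sum_(i < m) x 0 i)) |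
    x in @partial_permutohedron R m n].

Definition fmn (m n : nat) (A : {set 'I_(m + 1)}) : nat :=
  if rshift m ord0 \in A then n else minn #|A| n.

(* Main.v *)
Require Import Defs.
From mathcomp Require Import all_boot all_order all_algebra.
From mathcomp Require Import all_classical all_reals all_analysis.
From mathcomp Require Import perm ring lra zify.

(** Write z for the element m+1.  A selection is a word s_0, ..., s_(n-1) in the
    ground set in which only z may be repeated; weights d_0 > ... > d_(n-1) > 0
    turn it into the point sum_k d_k e_(s_k).  These points span the lifted
    partial permutohedron for d_k = n - k, and the base polytope of the flag
    polymatroid for d_k = 2(n - k) - 1.  On such a polytope the point of s
    maximizes c exactly when s is greedy for c, and this condition does not
    mention d; hence neither does the inclusion between the faces selected by two
    functionals, which determines the normal fan.

    The monotone path polytope lies in the base polytope because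
    2 int_0^n min(r, f(A)) dr = 2 n f(A) - f(A)^2, and it contains the points of
    all selections, each being obtained by integrating the path that moves along
    e_(s_0), ..., e_(s_(n-1)) in turn at unit speed. *)

Set Implicit Arguments.
Unset Strict Implicit.
Unset Printing Implicit Defensive.

Import Order.TTheory GRing.Theory Num.Theory.
Import numFieldNormedType.Exports.

Local Open Scope ring_scope.

(** * Selections and greedy selections *)

Section selections.
Variables (R : realType) (q n : nat) (z : 'I_q).
Implicit Types (c x : 'rV[R]_q) (s : {ffun 'I_n -> 'I_q}) (d : nat -> R).

Definition selection s :=
  [forall j, forall k, (s j == s k) && (s j != z) ==> (j == k)].

Lemma selectionP s :
  reflect (forall j k, s j = s k -> s j != z -> j = k) (selection s).
Proof.
apply: (iffP forallP) => [h j k e nz|h j].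
  by have /forallP/(_ k)/implyP := h j; rewrite e eqxx -e nz => /(_ isT)/eqP.
by apply/forallP => k; apply/implyP => /andP[/eqP e nz]; apply/eqP/h.
Qed.

(** Local optimality under two exchanges: swapping two positions, and replacing one letter by an
    available one, which is [z] or a letter outside the word. Only the preorder induced by [c]
    matters. *)
Definition greedy c s :=
  (forall j k : 'I_n, (j < k)%N -> c 0 (s k) <= c 0 (s j)) /\
  (forall i k, i = z \/ (forall j, s j != i) -> c 0 i <= c 0 (s k)).

Definition selection_point d s : 'rV[R]_q :=
  \row_i \sum_(k < n | s k == i) d k.

Lemma sum_selection_point d s (A : {set 'I_q}) :
  \sum_(i in A) selection_point d s 0 i = \sum_(k < n | s k \in A) d k.
Proof.
rewrite (partition_big s (fun i => i \in A)) //=.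
apply: eq_bigr => i iA; rewrite mxE; apply: eq_bigl => k.
by case: eqP => [->|]; rewrite ?iA ?andbF.
Qed.

Lemma dot_selection_point d c s :
  dot c (selection_point d s) = \sum_(k < n) d k * c 0 (s k).
Proof.
rewrite /dot (partition_big s xpredT) //=.
apply: eq_bigr => i _; rewrite mxE mulr_sumr; apply: eq_bigr => k /eqP ->.
by rewrite mulrC.
Qed.

(** Exchange argument: swapping positions [j] and [k] gains [(d j - d k) * (c 0 (s k) - c 0 (s j))],
    and putting [i] at position [k] gains [d k * (c 0 i - c 0 (s k))]. Neither gain can be
    positive. *)
Lemma optimal_greedy d c s :
  (forall j k, (j < k < n)%N -> d k < d j) -> (forall k, (k < n)%N -> 0 < d k) ->
  selection s ->
  (forall t, selection t ->
     dot c (selection_point d t) <= dot c (selection_point d s)) ->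
  greedy c s.
Proof.
move=> dd d0 /selectionP ss opt; split=> [j k jk|i k hi].
- have := opt [ffun i => s (tperm j k i)].
  have -> : selection [ffun i => s (tperm j k i)].
    by apply/selectionP => a b; rewrite !ffunE => /ss h /h /perm_inj.
  move=> /(_ isT); rewrite !dot_selection_point.
  have njk : k != j by apply: contraTneq jk => ->; rewrite ltnn.
  have split2 (F : 'I_n -> R) :
      \sum_i F i = F j + (F k + \sum_(i | (i != j) && (i != k)) F i).
    by rewrite (bigD1 j) //= (bigD1 k).
  rewrite !split2 !ffunE tpermL tpermR.
  rewrite (eq_bigr (fun i : 'I_n => d i * c 0 (s i))); last first.
    by move=> i /andP[ij ik]; rewrite ffunE tpermD // eq_sym.
  have := dd j k; rewrite jk ltn_ord => /(_ isT) dkj.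
  rewrite -subr_le0 => le0.
  rewrite -subr_le0 -(pmulr_rle0 _ (_ : 0 < d j - d k)) ?subr_gt0 //.
  by apply: le_trans le0; rewrite le_eqVlt; apply/orP; left; apply/eqP; ring.
- pose t := [ffun j => if j == k then i else s j].
  have : selection t.
    apply/selectionP => a b; rewrite !ffunE.
    have si a' : i != z -> s a' != i.
      by case: hi => [->|hi _]; rewrite ?eqxx.
    case: (eqVneq a k) => [->|ak]; case: (eqVneq b k) => [->|bk] //.
    + by move=> ib /(si b); rewrite -ib eqxx.
    + by move=> sa; rewrite sa => /(si a); rewrite sa eqxx.
    + exact: ss.
  move=> /opt; rewrite !dot_selection_point.
  rewrite (bigD1 k) //= [leRHS](bigD1 k) //= ffunE eqxx.
  rewrite (eq_bigr (fun i : 'I_n => d i * c 0 (s i))); last first.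
    by move=> a /negbTE ak; rewrite ffunE ak.
  by rewrite lerD2r ler_pM2l // d0.
Qed.

(** A best selection for one fixed choice of decreasing positive weights will do; the constant word
    [z] provides a candidate. *)
Lemma exists_greedy c : exists2 s, selection s & greedy c s.
Proof.
pose d k : R := (n - k)%:R.
have s0 : selection [ffun=> z].
  by apply/selectionP => j k; rewrite !ffunE eqxx.
have [s ss opt] := arg_maxP (fun s => dot c (selection_point d s)) s0.
exists s => //; apply: (@optimal_greedy d) => //.
- by move=> j k jk; rewrite ltr_nat; lia.
- by move=> k kn; rewrite ltr0n; lia.
Qed.

End selections.

(** * Coordinates and partial sums of selection points *)

Section selection_points.
Variables (R : realType) (q n : nat) (z : 'I_q).
Implicit Types (s : {ffun 'I_n -> 'I_q}) (d : nat -> R) (A : {set 'I_q}).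

Lemma sum_all_selection_point d s :
  \sum_i selection_point d s 0 i = \sum_(k < n) d k.
Proof.
rewrite [RHS](partition_big s xpredT) //=.
by apply: eq_bigr => i _; rewrite mxE.
Qed.

Lemma selection_point_eq d s k : selection z s -> s k != z ->
  selection_point d s 0 (s k) = d k.
Proof.
move=> /selectionP ss nz; rewrite mxE (big_pred1 k) // => j.
by apply/eqP/eqP => [/esym/ss -> //|->].
Qed.

Lemma selection_point_eq0 d s i : (forall k, s k != i) ->
  selection_point d s 0 i = 0.
Proof. by move=> si; rewrite mxE big_pred0 // => k; apply/negbTE. Qed.

Lemma card_selection s A : selection z s -> z \notin A ->
  (#|[pred k | s k \in A]| <= #|A|)%N.
Proof.
move=> /selectionP ss zA; rewrite -(@card_in_imset _ _ s).
  by apply/subset_leq_card/fintype.subsetP => i /imsetP[k kA ->].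
move=> j k jA _ jk; apply: ss jk _.
by apply: contraNneq zA => <-.
Qed.

Lemma sum_antitone_le d (P : pred 'I_n) (p : nat) :
  (forall j k, (j <= k < n)%N -> d k <= d j) -> (forall k, (k < n)%N -> 0 <= d k) ->
  (#|P| <= p <= n)%N -> \sum_(k < n | P k) d k <= \sum_(k < p) d k.
Proof.
case: p => [|p] dmon d0 /andP[cP pn].
  rewrite big_ord0 big1 // => k Pk; move: cP; rewrite leqn0 => /eqP/card0_eq/(_ k).
  by rewrite unfold_in Pk.
(* The size bound is now [p.+1], so [t] is the least of the [p.+1] largest weights. Subtracting it
   leaves nonnegative terms up to index [p] and nonpositive ones after, so passing to the initial
   segment cannot decrease the sum. *)
pose t := d p; have t0 : 0 <= t by exact: d0.
have -> : \sum_(k < p.+1) d k = \sum_(k < n | (k <= p)%N) d k.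
  by rewrite (big_ord_widen n (fun k => d k)).
have shift (Q : pred 'I_n) :
    \sum_(k < n | Q k) d k = \sum_(k < n | Q k) (d k - t) + t *+ #|Q|.
  by rewrite -sumr_const -big_split /=; apply: eq_bigr => k _; rewrite subrK.
rewrite !shift; apply: lerD; last first.
  rewrite -[leLHS]mulr_natr -[leRHS]mulr_natr ler_wpM2l ?ler_nat //.
  apply: leq_trans cP _.
  rewrite -sum1_card (eq_bigl (fun k : 'I_n => (k < p.+1)%N)) //.
  by rewrite -(big_ord_widen n (fun=> 1%N)) // sum1_card card_ord.
rewrite big_mkcond [leRHS]big_mkcond; apply: ler_sum => k _.
case: (leqP k p) => kp; case: ifP => // _.
  by rewrite subr_ge0; apply: dmon; rewrite kp.
by rewrite subr_le0; apply: dmon; rewrite ltnW //= ltn_ord.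
Qed.

End selection_points.

(** Summation by parts. Partial sums are compared only after multiplication by [b j - b j.+1], so a
    constant stretch of [b] imposes nothing; this accommodates repetitions of [z]. *)
Lemma Abel_sum_le (R : realDomainType) (b d y : nat -> R) (n : nat) :
  (forall j, (j < n)%N -> (b j - b j.+1) * \sum_(k < j.+1) y k <=
                          (b j - b j.+1) * \sum_(k < j.+1) d k) ->
  b n * \sum_(k < n.+1) y k <= b n * \sum_(k < n.+1) d k ->
  \sum_(k < n.+1) b k * y k <= \sum_(k < n.+1) b k * d k.
Proof.
have abel (u : nat -> R) : \sum_(k < n.+1) b k * u k =
    \sum_(j < n) (b j - b j.+1) * (\sum_(k < j.+1) u k) +
    b n * \sum_(k < n.+1) u k.
  elim: n => [|N IH]; first by rewrite big_ord0 add0r !big_ord1.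
  rewrite big_ord_recr IH [in RHS]big_ord_recr /= [in X in _ = _ + X]big_ord_recr /=.
  by ring.
move=> h hn; rewrite !abel lerD // ler_sum // => j _; exact: h.
Qed.

(** * Faces of polytopes spanned by selections *)

Section faces.
Variables (R : realType) (q n : nat) (z : 'I_q).
Implicit Types (c x : 'rV[R]_q) (s : {ffun 'I_n -> 'I_q}) (d : nat -> R).

(** Optimality of the greedy algorithm. Constraints on sets avoiding [z] suffice, because [c] at [z]
    never exceeds [c] at a selected letter. *)
Lemma dot_le_greedy d c x s : (0 < n)%N ->
  selection z s -> greedy z c s -> (forall i, 0 <= x 0 i) ->
  \sum_i x 0 i = \sum_(k < n) d k ->
  (forall A : {set 'I_q}, z \notin A -> (#|A| <= n)%N ->
     \sum_(i in A) x 0 i <= \sum_(k < #|A|) d k) ->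
  dot c x <= dot c (selection_point d s).
Proof.
case: n s => // p s _ /selectionP ss [smon sout] x0 xE xA.
rewrite dot_selection_point.
pose a k := c 0 (s (inord k)); pose y k := x 0 (s (inord k)).
have aE (k : 'I_p.+1) : a k = c 0 (s k) by rewrite /a inord_val.
have yE (k : 'I_p.+1) : y k = x 0 (s k) by rewrite /y inord_val.
(* Subtracting the last, hence least, selected value [a p] costs a constant, as the total of [x] is
   fixed, and makes the coefficients of unselected elements nonpositive. *)
have dotE : dot c x = \sum_i (c 0 i - a p) * x 0 i + a p * \sum_(k < p.+1) d k.
  rewrite -xE mulr_sumr -big_split /=; apply: eq_bigr => i _.
  by rewrite -mulrDl subrK.
have le1 : \sum_i (c 0 i - a p) * x 0 i <= \sum_(k < p.+1) (a k - a p) * y k.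
  rewrite [leRHS](partition_big s xpredT) //=; apply: ler_sum => i _.
  case: (boolP [forall k, s k != i]) => [/forallP nsi|/existsP[k /negPn/eqP ski]].
    rewrite big_pred0 => [|k]; last by rewrite (negbTE (nsi k)).
    by rewrite mulr_le0_ge0 // subr_le0 sout //; right.
  rewrite (eq_bigr (fun=> (c 0 i - a p) * x 0 i)); last first.
    by move=> j /eqP <-; rewrite aE yE.
  (* If [z] is selected, its value is the least selected one, so its coefficient vanishes whatever
     its multiplicity; any other selected element is hit once. *)
  have [iz|iz] := eqVneq i z.
    have -> : c 0 i = a p.
      apply/eqP; rewrite eq_le {1}/a sout; last by left.
      rewrite -ski -aE /a /=.
      have := leq_ord k; rewrite leq_eqVlt => /predU1P[->//|kp].
      by rewrite smon // !inordK //; lia.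
    by rewrite subrr mul0r big1 // => j _; rewrite mul0r.
  rewrite (big_pred1 k) // => j; apply/eqP/eqP => [sji|->//].
  by apply: ss; rewrite sji ?ski.
have le2 : \sum_(k < p.+1) (a k - a p) * y k <= \sum_(k < p.+1) (a k - a p) * d k.
  apply: (@Abel_sum_le _ (fun k => a k - a p) d y p); last first.
    by rewrite subrr !mul0r.
  move=> j jp; rewrite opprB addrA subrK.
  have : 0 <= a j - a j.+1.
    by rewrite subr_ge0 smon // !inordK //; lia.
  rewrite le_eqVlt => /predU1P[<-|aj]; first by rewrite !mul0r.
  rewrite ler_pM2l //.
  (* A strict drop after position [j] excludes [z] from the first [j.+1] letters, since its value is
     at most [a j.+1]. These letters are thus distinct, and the bound for the set [A] they form
     applies. *)
  have nz (k : 'I_j.+1) : s (inord k) != z.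
    apply/negP => /eqP skz.
    have : a j <= a j.+1.
      apply: (@le_trans _ _ (a k)).
        have := leq_ord k; rewrite leq_eqVlt => /predU1P[->//|kj].
        by rewrite smon // !inordK //; have := ltn_ord k; lia.
      by rewrite /a skz sout //; left.
    by rewrite leNgt -subr_gt0 aj.
  have inj : injective (fun k : 'I_j.+1 => s (inord k)).
    move=> k l /ss /(_ (nz k)) /(congr1 val).
    by rewrite /= !inordK; [move/val_inj|have := ltn_ord l; lia|have := ltn_ord k; lia].
  pose A := [set s (inord (k : 'I_j.+1)) | k in 'I_j.+1]%SET.
  have cA : #|A| = j.+1 by rewrite card_imset // card_ord.
  have -> : \sum_(k < j.+1) y k = \sum_(i in A) x 0 i.
    by rewrite big_imset //= => k l _ _; apply: inj.
  rewrite -cA; apply: xA; last by rewrite cA; lia.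
  by apply/imsetP => -[k _ /eqP]; rewrite eq_sym (negbTE (nz k)).
rewrite dotE; apply: (@le_trans _ _ (\sum_(k < p.+1) (a k - a p) * d k +
   a p * \sum_(k < p.+1) d k)).
  by rewrite lerD2r (le_trans le1).
rewrite mulr_sumr -big_split /=; apply: ler_sum => k _.
by rewrite -mulrDl subrK aE mulrC.
Qed.

Lemma dotB c c' x : dot (c - c') x = dot c x - dot c' x.
Proof. by rewrite /dot -sumrB; apply: eq_bigr => i _; rewrite !mxE mulrBl. Qed.

Lemma dotZ (t : R) c x : dot (t *: c) x = t * dot c x.
Proof. by rewrite /dot mulr_sumr; apply: eq_bigr => i _; rewrite !mxE mulrA. Qed.

Lemma greedy_le c c' s : (forall i j, c' 0 i <= c' 0 j -> c 0 i <= c 0 j) ->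
  greedy z c' s -> greedy z c s.
Proof. by move=> h [g1 g2]; split=> *; apply: h; [apply: g1|apply: g2]. Qed.

(** For large [t], subtracting [c'] from [t *: c] cannot undo a strict inequality of [c]. *)
Lemma dominating_multiple c c' : exists2 t : R, 0 < t &
  forall i j, (t *: c - c') 0 i <= (t *: c - c') 0 j -> c 0 i <= c 0 j.
Proof.
pose u i j := `|c' 0 i - c' 0 j| / `|c 0 i - c 0 j|.
have u0 i j : 0 <= u i j by rewrite divr_ge0.
pose t := 1 + \sum_i \sum_j u i j.
have tu i j : u i j < t.
  rewrite /t (bigD1 i) //= (bigD1 j) //=.
  have rest1 : 0 <= \sum_(k | k != j) u i k by exact: sumr_ge0.
  have rest2 : 0 <= \sum_(k | k != i) \sum_l u k l.
    by apply: sumr_ge0 => k _; exact: sumr_ge0.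
  lra.
exists t => [|i j]; first by apply: ltr_pwDl => //; do 2!apply: sumr_ge0 => ? _.
rewrite !mxE => h; rewrite leNgt; apply/negP => cji.
have := tu i j; rewrite /u ltr_pdivrMr ?normr_gt0 ?subr_eq0 ?gt_eqF //.
rewrite [X in _ < _ * X]gtr0_norm ?subr_gt0 // => tc.
have := ler_norm (c' 0 i - c' 0 j); lra.
Qed.

(* [c' in normal_cone P (face P c)] says that [t c] splits as a sum of two
   functionals lying in a common normal cone of a vertex, for large [t]; such a
   cone is the set of functionals for which a fixed selection is greedy. *)
Definition greedy_compatible c c' := exists t s,
  [/\ 0 < t, selection z s, greedy z c s, greedy z c' s & greedy z (t *: c - c') s].

(** Stated for an arbitrary set, so that it applies to [MPP] from its selection points and its
    inclusion in the base polytope alone. *)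
Definition greedy_polytope d (P : set 'rV[R]_q) :=
  (forall s, selection z s -> P (selection_point d s)) /\
  (forall c x s, P x -> selection z s -> greedy z c s ->
     dot c x <= dot c (selection_point d s)).

(** Forward: a word greedy for [t *: c - c'] is greedy for [c], so its point lies in both faces and
    the word is greedy for [c']. Backward: a maximizer [x] of [c] ties with the point of [s] for
    [t *: c], and cannot beat it for [t *: c - c'], so it does at least as well for [c']. *)
Lemma face_subsetP d P c c' :
  (forall j k, (j < k < n)%N -> d k < d j) -> (forall k, (k < n)%N -> 0 < d k) ->
  greedy_polytope d P ->
  (face P c `<=` face P c')%classic <-> greedy_compatible c c'.
Proof.
move=> dd d0 [Psel Pup]; split=> [sub|[t [s [t0 ss gc gc' gd]]] x [Px xmax]].
- have [t t0 tP] := dominating_multiple c c'.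
  have [s ss gd] := exists_greedy n z (t *: c - c').
  have gc : greedy z c s by apply: greedy_le gd.
  exists t, s; split => //.
  have [|_ smax] := sub (selection_point d s).
    by split=> [|y Py]; [exact: Psel|exact: Pup].
  by apply: (optimal_greedy dd d0 ss) => u su; apply: smax; exact: Psel.
- split=> // y Py; apply: le_trans (Pup c' y s Py ss gc') _.
  have := xmax _ (Psel s ss); rewrite -(ler_pM2l t0).
  by have := Pup _ x s Px ss gd; rewrite !dotB !dotZ; lra.
Qed.

Lemma greedy_polytope_normally_equivalent d d' P P' :
  (forall j k, (j < k < n)%N -> d k < d j) -> (forall k, (k < n)%N -> 0 < d k) ->
  (forall j k, (j < k < n)%N -> d' k < d' j) -> (forall k, (k < n)%N -> 0 < d' k) ->
  greedy_polytope d P -> greedy_polytope d' P' -> normally_equivalent P P'.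
Proof.
move=> dd d0 dd' d0' gP gP'.
have coneE c : normal_cone P (face P c) = normal_cone P' (face P' c).
  apply/seteqP; split=> c' h.
    exact: (face_subsetP c c' dd' d0' gP').2 ((face_subsetP c c' dd d0 gP).1 h).
  exact: (face_subsetP c c' dd d0 gP).2 ((face_subsetP c c' dd' d0' gP').1 h).
by apply/seteqP; split => N [c ->]; exists c; rewrite coneE.
Qed.

End faces.

(** * Integrals *)

Lemma Rintegral_sum d (T : measurableType d) (R : realType)
    (mu : {measure set T -> \bar R}) (I : finType) (P : {pred I}) (D : set T)
    (f : I -> T -> R) :
  measurable D -> (forall i, mu.-integrable D (EFin \o f i)) ->
  \int[mu]_(s in D) \sum_(i in P) f i s = \sum_(i in P) \int[mu]_(s in D) f i s.
Proof.
move=> mD intf; rewrite /Rintegral.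
under eq_integral do rewrite -sumEFin.
rewrite integral_sum // -sum_fine // => i _.
exact: (integrable_fin_num mD (intf i)).
Qed.

Section integrals.
Variable R : realType.
Notation mu := (@lebesgue_measure R).

Lemma continuous_itv_integrable (a b : R) (f : R -> R) :
  continuous f -> mu.-integrable `[a, b]%classic (EFin \o f).
Proof.
move=> cf; apply: continuous_compact_integrable; first exact: segment_compact.
exact: continuous_subspaceT.
Qed.

Lemma continuous_min_cst (a : R) : continuous (fun s : R => Num.min s a).
Proof. by move=> x; apply: continuous_min; [exact: cvg_id|exact: cvg_cst]. Qed.

Lemma Rintegral_id (a : R) : 0 <= a ->
  \int[mu]_(s in `[0, a]%classic) s = a ^+ 2 / 2.
Proof.
rewrite le_eqVlt => /predU1P[<-|a0].
  by rewrite set_itv1 Rintegral_set1 expr0n mul0r.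
rewrite /Rintegral (@continuous_FTC2 _ id (fun s => s ^+ 2 / 2)) //=.
- by rewrite expr0n mul0r subr0.
- by apply: continuous_subspaceT => x; exact: cvg_id.
- have cF : continuous (fun s : R => s ^+ 2 / 2).
    by move=> x; apply: cvgMl; exact: exprn_continuous.
  split.
  + by move=> x _; apply: derivableM => //; exact: exprn_derivable.
  + by apply: cvg_at_right_filter; exact: cF.
  + by apply: cvg_at_left_filter; exact: cF.
- move=> x _; rewrite derive1Mr; last exact: exprn_derivable.
  by rewrite exp_derive1 /= expr1 /GRing.scale /=; field.
Qed.

Lemma Rintegral_min (a b : R) : 0 <= a -> a <= b ->
  \int[mu]_(s in `[0, b]%classic) Num.min s a = a * b - a ^+ 2 / 2.
Proof.
move=> a0 ab.
have intm := @continuous_itv_integrable 0 b _ (@continuous_min_cst a).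
(* Split at [a], where the integrand turns from [s] into a constant. *)
have := Rintegral_itvB (x := a) intm.
rewrite !bnd_simp => /(_ a0 ab).
have -> : \int[mu]_(s in `[0, a]%classic) Num.min s a = a ^+ 2 / 2.
  rewrite -Rintegral_id //; apply: eq_Rintegral => s.
  by rewrite inE /= in_itv /= => /andP[_ sa]; exact: min_l.
have -> : \int[mu]_(s in `]a, b]%classic) Num.min s a = a * (b - a).
  rewrite (_ : b - a = fine (mu `]a, b]%classic)).
    rewrite -Rintegral_cst //; apply: eq_Rintegral => s.
    by rewrite inE /= in_itv /= => /andP[/ltW sa _]; exact: min_r.
  rewrite lebesgue_measure_itv /= lte_fin; case: ltP => //= ba.
  by apply/eqP; rewrite subr_eq0 eq_le ab ba.
by move/eqP; rewrite subr_eq => /eqP ->; field.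
Qed.

End integrals.

(** * The lifted partial permutohedron *)

Section lifted_partial_permutohedron.
Variables (R : realType) (m n : nat).
Notation z := (rshift m ord0 : 'I_(m + 1)).
Implicit Types (c v : 'rV[R]_(m + 1)) (s : {ffun 'I_n -> 'I_(m + 1)}).

Definition lift_coordinate (x : 'rV[R]_m) : 'rV[R]_(m + 1) :=
  row_mx x (const_mx ('C(n.+1, 2)%:R - \sum_(i < m) x 0 i)).

Lemma lift_coordinate_lsubmx v : \sum_i v 0 i = 'C(n.+1, 2)%:R ->
  lift_coordinate (lsubmx v) = v.
Proof.
move=> vC; rewrite /lift_coordinate -[RHS]hsubmxK; congr row_mx.
apply/rowP => j; rewrite [LHS]mxE [RHS]mxE -vC big_split_ord /= big_ord1.
have -> : \sum_(i < m) lsubmx v 0 i = \sum_(i < m) v 0 (lshift 1 i).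
  by apply: eq_bigr => i _; rewrite mxE.
by rewrite addrAC subrr add0r (ord1 j).
Qed.

Let weight (k : nat) : R := (n - k)%:R.

Lemma sum_weight : \sum_(k < n) weight k = 'C(n.+1, 2)%:R.
Proof.
rewrite -natr_sum; congr (_%:R); rewrite -bin2_sum big_mkord big_ord_recl add0n /=.
rewrite (reindex_inj rev_ord_inj) /=; apply: eq_bigr => k _.
by rewrite /bump /=; have := ltn_ord k; lia.
Qed.

(** The [k]-th letter is the coordinate of value [n - k], unique by distinctness, or [z] if that
    value does not occur. *)
Lemma partial_permutation_selection x : partial_permutation n x ->
  exists2 s : {ffun 'I_n -> 'I_(m + 1)}, selection z s &
    lift_coordinate x = selection_point weight s.
Proof.
move=> [xn xinj].
pose s : {ffun 'I_n -> 'I_(m + 1)} := [ffun k : 'I_n =>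
  if [pick i | x 0 i == weight k] is Some i then lshift 1 i else z].
have lz i : lshift 1 i != z by rewrite eq_lrshift.
have weight0 (k : 'I_n) : weight k != 0.
  by rewrite pnatr_eq0 -lt0n subn_gt0.
have weight_inj (j k : 'I_n) : weight j = weight k -> j = k.
  move=> /eqP; rewrite eqr_nat => /eqP jk; apply: val_inj => /=.
  by have := ltn_ord j; have := ltn_ord k; lia.
have sP k i : s k = lshift 1 i -> x 0 i = weight k.
  rewrite ffunE; case: pickP => [j /eqP xj /lshift_inj <- //|_ /esym/eqP].
  by rewrite (negbTE (lz i)).
have ss : selection z s.
  apply/selectionP => j k; case: (split_ordP (s j)) => [i sj sk _|i ->].
    by apply: weight_inj; rewrite -(sP _ _ sj) (sP k i) -?sk.
  by rewrite ord1 eqxx.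
have s_hit (k : 'I_n) i : x 0 i = weight k -> s k = lshift 1 i.
  rewrite ffunE => xi; case: pickP => [j /eqP xj|/(_ i)]; last by rewrite xi eqxx.
  congr lshift; apply/eqP; apply/negPn/negP => ij.
  by have := xinj j i; rewrite xj xi weight0 eqxx => /(_ isT isT ij).
(* Both points have total ['C(n.+1, 2)], so comparing the first [m] coordinates is enough. *)
exists s => //; rewrite -[RHS]lift_coordinate_lsubmx; last first.
  by rewrite sum_all_selection_point sum_weight.
congr lift_coordinate; apply/rowP => i; rewrite mxE.
have [[k /eqP sk]|] := pselect (exists k, s k == lshift 1 i).
  by rewrite -sk (selection_point_eq _ ss) ?sk // (sP _ _ sk).
move=> /forallNP ns; rewrite selection_point_eq0; last by move=> k; apply/negP/ns.
have [[|j] jn xj] := xn i; first by rewrite xj.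
have kn : (n - j.+1 < n)%N by lia.
case: (ns (Ordinal kn)); apply/eqP/s_hit.
by rewrite xj /weight /= subKn.
Qed.

Lemma selection_partial_permutation s : selection z s ->
  partial_permutation n (lsubmx (selection_point weight s)).
Proof.
move=> ss.
have lz i : lshift 1 i != z by rewrite eq_lrshift.
have hit i : lsubmx (selection_point weight s) 0 i != 0 ->
    exists2 k, s k = lshift 1 i & lsubmx (selection_point weight s) 0 i = weight k.
  rewrite mxE => nz.
  have [[k /eqP sk]|/forallNP ns] := pselect (exists k, s k == lshift 1 i).
    by exists k => //; rewrite -sk (selection_point_eq _ ss) ?sk.
  by rewrite selection_point_eq0 ?eqxx // in nz => k; apply/negP/ns.
split=> [i|i j /hit[k sk ->] /hit[l sl ->] ij].
  have [->|/hit[k _ ->]] := eqVneq (lsubmx (selection_point weight s) 0 i) 0.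
    by exists 0%N.
  by exists (n - k)%N => //; exact: leq_subr.
apply: contra_neq ij => /eqP; rewrite eqr_nat => /eqP kl.
have {}kl : k = l.
  by apply: val_inj => /=; have := ltn_ord l; have := ltn_ord k; lia.
by apply: (@lshift_inj m 1); rewrite -sk -sl kl.
Qed.

Lemma lifted_greedy_polytope : (0 < n)%N ->
  greedy_polytope n z weight (@lifted_partial_permutohedron R m n).
Proof.
move=> n0; split=> [s ss|c v s].
  exists (lsubmx (selection_point weight s)).
    by apply: sub_gen_smallest; exact: selection_partial_permutation.
  by rewrite -[LHS]/(lift_coordinate _) lift_coordinate_lsubmx //
    sum_all_selection_point sum_weight.
move=> [x hx <-] ss gs; rewrite -[X in dot c X]/(lift_coordinate x).
(* The hull is the least convex set containing the partial permutations, so it lies in [H] once [H]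
   is convex and contains them. *)
pose H : set 'rV[R]_m :=
  [set y | dot c (lift_coordinate y) <= dot c (selection_point weight s)]%classic.
suff : H x by [].
apply: (hx H); split=> [y y' l|y /partial_permutation_selection [t st ty]].
  rewrite !inE /H /= => hy hy'; pose a : R := l%:num.
  have a0 : 0 <= a by rewrite /a.
  have a1 : 0 <= 1 - a by rewrite subr_ge0 /a.
  (* The lift is affine: its constant term survives because the coefficients sum to 1. *)
  have -> : lift_coordinate (conv l y y') =
      a *: lift_coordinate y + (1 - a) *: lift_coordinate y'.
    rewrite /lift_coordinate !scale_row_mx add_row_mx; congr row_mx.
    apply/rowP => i; rewrite !mxE.
    have -> : \sum_(i < m) (conv l y y') 0 i =
        a * \sum_(i < m) y 0 i + (1 - a) * \sum_(i < m) y' 0 i.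
      by rewrite !mulr_sumr -big_split /=; apply: eq_bigr => k _; rewrite !mxE.
    by ring.
  have dotD (u w : 'rV[R]_(m + 1)) :
      dot c (a *: u + (1 - a) *: w) = a * dot c u + (1 - a) * dot c w.
    rewrite /dot !mulr_sumr -big_split /=; apply: eq_bigr => k _.
    by rewrite !mxE; ring.
  rewrite dotD; have := ler_wpM2l a0 hy; have := ler_wpM2l a1 hy'; lra.
rewrite /H /= ty; apply: (dot_le_greedy n0 ss gs) => [i||A zA An].
- by rewrite mxE sumr_ge0.
- exact: sum_all_selection_point.
rewrite sum_selection_point; apply: sum_antitone_le => //.
- by move=> j k jk; rewrite ler_nat; lia.
- by rewrite (card_selection st zA) An.
Qed.

End lifted_partial_permutohedron.

(** * The flag polymatroid and the monotone path polytope *)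

Lemma big_finsetT (R : nmodType) (T : finType) (F : T -> R) :
  \sum_(i in finset.setTfor T) F i = \sum_i F i.
Proof. by apply: eq_bigl => i; rewrite finset.in_setT. Qed.

Section flag_polymatroid.
Variables (R : realType) (m n : nat).
Notation z := (rshift m ord0 : 'I_(m + 1)).
Notation f := (fun A : {set 'I_(m + 1)} => (fmn n A)%:R : R).
Notation mu := (@lebesgue_measure R).
Notation ones := (const_mx 1 : 'rV[R]_(m + 1)).
Implicit Types (s : {ffun 'I_n -> 'I_(m + 1)}) (A : {set 'I_(m + 1)}).

(** The increments of [2 * n * p - p ^ 2], the flag polymatroid's value at rank [p]. *)
Definition flag_weight (k : nat) : R := 2 * n%:R - 2 * k%:R - 1.

Lemma sum_flag_weight (p : nat) :
  \sum_(k < p) flag_weight k = 2 * n%:R * p%:R - p%:R ^+ 2.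
Proof.
elim: p => [|p IH]; first by rewrite big_ord0; ring.
by rewrite big_ord_recr /= IH /flag_weight -natr1; ring.
Qed.

Lemma fmn_notin A : z \notin A -> fmn n A = minn #|A| n.
Proof. by rewrite /fmn => /negbTE ->. Qed.

Lemma fmn_le A : (fmn n A <= n)%N.
Proof. by rewrite /fmn; case: ifP => // _; exact: geq_minr. Qed.

Lemma fmn_setT : fmn n (finset.setTfor 'I_(m + 1)) = n.
Proof. by rewrite /fmn finset.in_setT. Qed.

Lemma dot_ones (x : 'rV[R]_(m + 1)) : dot ones x = \sum_i x 0 i.
Proof. by apply: eq_bigr => i _; rewrite mxE mul1r. Qed.

Lemma card_selection_fmn s A : selection z s ->
  (#|[pred k | s k \in A]| <= fmn n A)%N.
Proof.
move=> ss; have le_n : (#|[pred k | s k \in A]| <= n)%N.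
  by rewrite (leq_trans (max_card _)) ?card_ord.
have [zA|zA] := boolP (z \in A); first by rewrite /fmn zA.
by rewrite fmn_notin // leq_min le_n andbT (card_selection ss).
Qed.

(** The clamp of [r - k] to the unit interval, written with truncations so that sums telescope and
    integrals reduce to [Rintegral_min]. *)
Definition rise (k : nat) (r : R) : R := Num.min r k.+1%:R - Num.min r k%:R.

(* The greedy path: time [k, k+1] is spent moving along the basis vector of the
   [k]-th selected element at unit speed. *)
Definition selection_path s (r : R) : 'rV[R]_(m + 1) :=
  selection_point (fun k => rise k r) s.

Lemma rise_ge0 k r : 0 <= rise k r.
Proof.
rewrite /rise -natr1.
by case: (leP r (k%:R + 1)) => h1; case: (leP r k%:R) => h2; lra.
Qed.

Lemma rise_le1 k r : rise k r <= 1.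
Proof.
rewrite /rise -natr1.
by case: (leP r (k%:R + 1)) => h1; case: (leP r k%:R) => h2; lra.
Qed.

Lemma sum_rise r : 0 <= r <= n%:R -> \sum_(k < n) rise k r = r.
Proof.
move=> /andP[r0 rn].
rewrite -(big_mkord xpredT (fun k => rise k r)).
rewrite (telescope_sumr (fun k : nat => Num.min r k%:R)) //.
by rewrite (min_l rn) (min_r r0) subr0.
Qed.

Lemma continuous_rise k : continuous (rise k).
Proof. by move=> r; apply: cvgB; exact: continuous_min_cst. Qed.

Lemma Rintegral_rise (k : 'I_n) :
  2 * \int[mu]_(r in `[0, n%:R]%classic) rise k r = flag_weight k.
Proof.
rewrite RintegralB //; last 2 first.
- by apply: continuous_itv_integrable; exact: continuous_min_cst.
- by apply: continuous_itv_integrable; exact: continuous_min_cst.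
rewrite !Rintegral_min ?ler0n ?ler_nat ?(ltnW (ltn_ord k)) //.
by rewrite /flag_weight -natr1; field.
Qed.

Lemma selection_path_polymatroid s (r : R) : selection z s -> 0 <= r <= n%:R ->
  polymatroid_polytope f (selection_path s r) /\ dot ones (selection_path s r) = r.
Proof.
move=> ss rn; split; last by rewrite dot_ones sum_all_selection_point sum_rise.
split=> [i|A]; first by rewrite mxE sumr_ge0 // => k _; exact: rise_ge0.
rewrite sum_selection_point; apply: (@le_trans _ _ (\sum_(k < n | s k \in A) 1)).
  by apply: ler_sum => k _; exact: rise_le1.
by rewrite sumr_const ler_nat; exact: card_selection_fmn.
Qed.

Lemma image_polymatroid_polytope :
  (dot ones @` polymatroid_polytope f = `[0, n%:R])%classic.
Proof.
apply/seteqP; split=> [_ [x [x0 xA] <-]|r] /=; rewrite in_itv /=.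
  rewrite dot_ones sumr_ge0 //=.
  by have := xA (finset.setTfor _); rewrite fmn_setT big_finsetT.
(* The path of the constant word [z] realizes every value [r]. *)
move=> rn; pose s : {ffun 'I_n -> 'I_(m + 1)} := [ffun=> z].
have ss : selection z s.
  by apply/selectionP => j k; rewrite !ffunE eqxx.
have [] := selection_path_polymatroid ss rn.
by exists (selection_path s r).
Qed.

Lemma continuous_selection_path s : continuous (selection_path s).
Proof.
have -> : selection_path s =
    fun r => \sum_(k < n) rise k r *: (delta_mx 0 (s k) : 'rV[R]_(m + 1)).
  apply/funext => r; apply/rowP => i; rewrite mxE summxE big_mkcond /=.
  apply: eq_bigr => k _; rewrite !mxE eqxx /= eq_sym.
  by case: eqP => _; rewrite ?mulr1 ?mulr0.
apply: continuous_big => [|k _]; first exact: add_continuous.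
by move=> r; apply: cvgZr_tmp; exact: continuous_rise.
Qed.

Lemma selection_point_MPP s : selection z s ->
  MPP ones (polymatroid_polytope f) (selection_point flag_weight s).
Proof.
move=> ss; exists (selection_path s).
  rewrite /monotone_section image_polymatroid_polytope; split=> [|r].
    exact: continuous_subspaceT (@continuous_selection_path s).
  by rewrite /= in_itv /=; exact: selection_path_polymatroid.
rewrite image_polymatroid_polytope; apply/rowP => i; rewrite !mxE.
under eq_Rintegral do rewrite mxE.
rewrite Rintegral_sum //; last first.
  by move=> k; apply: continuous_itv_integrable; exact: continuous_rise.
by rewrite mulr_sumr; apply: eq_bigr => k _; rewrite Rintegral_rise.
Qed.

(** At time [r], the coordinates of the section in [A] sum to at most [f A] and at most the total
    [r]; integrate the minimum of the two bounds. *)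
Lemma MPP_sub_base :
  (MPP ones (polymatroid_polytope f) `<=` base_polytope (flag_polymatroid f))%classic.
Proof.
move=> x [g]; rewrite /monotone_section image_polymatroid_polytope => -[cg gP] ->.
have intg i : mu.-integrable `[0, n%:R]%classic (EFin \o (fun r => g r 0 i)).
  apply: continuous_compact_integrable; first exact: segment_compact.
  apply: (@within_continuous_comp _ _ _ _ g (fun v : 'rV[R]_(m + 1) => v 0 i)) cg.
  by move=> v _; exact: coord_continuous.
have sumE A : \sum_(i in A) (2 *: \row_(i < m + 1)
      \int[mu]_(r in `[0, n%:R]%classic) g r 0 i) 0 i =
    2 * \int[mu]_(r in `[0, n%:R]%classic) \sum_(i in A) g r 0 i.
  by rewrite Rintegral_sum // mulr_sumr; apply: eq_bigr => i _; rewrite !mxE.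
have flagE A : flag_polymatroid f A =
    2 * \int[mu]_(r in `[0, n%:R]%classic) Num.min r (f A).
  by rewrite Rintegral_min ?ler_nat ?fmn_le // /flag_polymatroid fmn_setT; field.
have sum_g r : 0 <= r <= n%:R -> \sum_i g r 0 i = r.
  by move=> rn; have [] := gP r; rewrite /= ?in_itv // dot_ones.
have intmin a : mu.-integrable `[0, n%:R]%classic (EFin \o (fun r => Num.min r a)).
  by apply: continuous_itv_integrable; exact: continuous_min_cst.
split; first split.
- move=> i; rewrite !mxE mulr_ge0 // Rintegral_ge0 // => r rn.
  by have [[]] := gP r rn.
- move=> A; rewrite sumE flagE ler_pM2l //; apply: le_Rintegral => //.
    rewrite (_ : EFin \o _ = fun r => (\sum_(i in A) (g r 0 i)%:E)%E).
      by apply: integrable_sum => // i _; exact: (intg i).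
    by apply/funext => r; rewrite /= sumEFin.
  move=> r rn; have [[g0 gA] _] := gP r rn.
  rewrite le_min gA andbT -[leRHS](sum_g r) ?in_itv //.
  by rewrite [leRHS](bigID (mem A)) /= lerDl sumr_ge0.
- rewrite -big_finsetT sumE flagE fmn_setT; congr (2 * _).
  apply: eq_Rintegral => r; rewrite inE /= in_itv /= => rn.
  by rewrite big_finsetT sum_g // min_l //; case/andP: rn.
Qed.

(** * Greedy optimality with the flag weights *)

Lemma flag_weight_decreasing j k : (j < k < n)%N -> flag_weight k < flag_weight j.
Proof.
move=> /andP[jk _]; have : j%:R < k%:R :> R by rewrite ltr_nat.
by rewrite /flag_weight; lra.
Qed.

Lemma flag_weight_gt0 k : (k < n)%N -> 0 < flag_weight k.
Proof.
move=> kn; have : k.+1%:R <= n%:R :> R by rewrite ler_nat.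
by rewrite /flag_weight -natr1; lra.
Qed.

(** If [A] avoids [z] and has at most [n] elements, its rank is [#|A|], so its flag value is the sum
    of the first [#|A|] weights, as [dot_le_greedy] demands. *)
Lemma base_dot_le_greedy (c x : 'rV[R]_(m + 1)) s : (0 < n)%N ->
  base_polytope (flag_polymatroid f) x -> selection z s -> greedy z c s ->
  dot c x <= dot c (selection_point flag_weight s).
Proof.
move=> n0 [[x0 xA] xE] ss gs; apply: (dot_le_greedy n0 ss gs x0).
  by rewrite xE sum_flag_weight /flag_polymatroid fmn_setT.
move=> A zA An; apply: le_trans (xA A) _; rewrite sum_flag_weight.
by rewrite /flag_polymatroid fmn_setT fmn_notin // (minn_idPl An).
Qed.

(** Selection points reach the base polytope by way of [MPP]. *)
Lemma base_greedy_polytope : (0 < n)%N ->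
  greedy_polytope n z flag_weight (base_polytope (flag_polymatroid f)).
Proof.
move=> n0; split=> [s ss|c x s]; last exact: base_dot_le_greedy.
exact/MPP_sub_base/selection_point_MPP.
Qed.

Lemma MPP_greedy_polytope : (0 < n)%N ->
  greedy_polytope n z flag_weight (MPP ones (polymatroid_polytope f)).
Proof.
move=> n0; split=> [s ss|c x s xP]; first exact: selection_point_MPP.
exact/base_dot_le_greedy/MPP_sub_base.
Qed.

End flag_polymatroid.

Theorem theorem7p3 (R : realType) (m n : nat) (n_ge1 : (1 <= n)%N)
    (n_le_m : (n <= m)%N) :
  let f : {set 'I_(m + 1)} -> R := fun A => (fmn n A)%:R in
  normally_equivalent (@lifted_partial_permutohedron R m n)
    (MPP (const_mx 1) (polymatroid_polytope f)) /\
  normally_equivalent (@lifted_partial_permutohedron R m n)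
    (base_polytope (flag_polymatroid f)).
Proof.
have fan P : greedy_polytope n (rshift m ord0) (flag_weight R n) P ->
    normally_equivalent (@lifted_partial_permutohedron R m n) P.
  move=> gP; apply: greedy_polytope_normally_equivalent
    (lifted_greedy_polytope R m n_ge1) gP.
  - by move=> j k jk; rewrite ltr_nat; lia.
  - by move=> k kn; rewrite ltr0n; lia.
  - exact: flag_weight_decreasing.
  - exact: flag_weight_gt0.
split; apply: fan; first exact: MPP_greedy_polytope.
exact: base_greedy_polytope.
Qed.
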